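(* Let $\mathbf{t}$ be the Thue-Morse word, with complexity function $P$ and window complexity function $P^w$. Then for every integer $n\ge 1$, $$P^w(n)=P\left(\frac{n}{2^{\upsilon_2(n)}}\right),$$ where $\upsilon_2(n)$ denotes the dyadic ($2$-adic) valuation of $n$. In particular, $P^w(n)=P(n)$ if $n$ is odd.
   Context: The Thue-Morse word $\mathbf{t}=\mathbf{t}_0\mathbf{t}_1\mathbf{t}_2\cdots$ over $\{a,b\}$ is defined by $\mathbf{t}_0=a$, $\mathbf{t}_1=b$ and, for all $n\ge 0$, $\mathbf{t}_{2n}=\mathbf{t}_n$, $\mathbf{t}_{2n+1}=\overline{\mathbf{t}_n}$, where $\overline{a}=b$ and $\overline{b}=a$; equivalently it is the fixed point beginning with $a$ of the morphism $a\mapsto ab$, $b\mapsto ba$. For an infinite word $u=u_0u_1u_2\cdots$, the complexity is $P_u(n)=\#\{u_ku_{k+1}\cdots u_{k+n-1}: k\ge 0\}$, and the window complexity is $P^w_u(n)=\#\{u_{kn}u_{kn+1}\cdots u_{(k+1)n-1}: k\ge 0\}$. Here $P=P_{\mathbf{t}}$ and $P^w=P^w_{\mathbf{t}}$. *)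

(* Defs.v *)
From Stdlib Require Import BinNums.
From mathcomp Require Import all_boot.
From mathcomp Require Import boolp.

Set Implicit Arguments.
Unset Strict Implicit.
Unset Printing Implicit Defensive.

(* An infinite word over A is a function u : nat -> A. *)

Definition factor (A : Type) (u : nat -> A) (n k : nat) : n.-tuple A :=
  [tuple u (k + i) | i < n].

Definition complexity (A : finType) (u : nat -> A) (n : nat) : nat :=
  #|[set w : n.-tuple A | `[< exists k : nat, w = factor u n k >]]|.

Definition window_complexity (A : finType) (u : nat -> A) (n : nat) : nat :=
  #|[set w : n.-tuple A | `[< exists k : nat, w = factor u n (k * n) >]]|.

(* The alphabet {a, b} is bool, with a = false, b = true, so that the
   exchange of letters is negb. The recursion on binary numerals encodes
   t_(2n) = t_n and t_(2n+1) = ~~ t_n; see thue_morse_even and thue_morse_odd. *)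

Fixpoint thue_morse_pos (p : positive) : bool :=
  match p with
  | xH => true
  | xO q => thue_morse_pos q
  | xI q => ~~ thue_morse_pos q
  end.

Definition thue_morse (n : nat) : bool :=
  match bin_of_nat n with
  | N0 => false
  | Npos p => thue_morse_pos p
  end.

Lemma thue_morse0 : thue_morse 0 = false.
Proof. by []. Qed.

Lemma thue_morse1 : thue_morse 1 = true.
Proof. by []. Qed.

Lemma thue_morse_even (n : nat) : thue_morse (2 * n) = thue_morse n.
Proof.
rewrite /thue_morse -{1}[n]bin_of_natK mul2n; case: (bin_of_nat n) => [|p] //.
have -> : (nat_of_bin (Npos p)).*2 = Npos (xO p) by rewrite /= NatTrec.doubleE.
by rewrite nat_of_binK.
Qed.

Lemma thue_morse_odd (n : nat) : thue_morse (2 * n + 1) = ~~ thue_morse n.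
Proof.
rewrite /thue_morse -{1}[n]bin_of_natK mul2n addn1.
case: (bin_of_nat n) => [|p] //.
have -> : (nat_of_bin (Npos p)).*2.+1 = Npos (xI p)
  by rewrite /= NatTrec.doubleE.
by rewrite nat_of_binK.
Qed.

(* Main.v *)
(* Write [t] for the Thue-Morse word.  Windows of length [2n] are the images of
   windows of length [n] under the injective morphism a -> ab, b -> ba, so
   P^w(2n) = P^w(n) and it remains to show P^w(n) = P(n) for [n] odd.  There
   [2 ^ L = 1 %[mod n]] with [L = totient n], and
   [t (2 ^ m * j + i) = t j (+) t i] whenever [i < 2 ^ m].  So a factor at
   position [k] recurs at every position [2 ^ (L * M) * j + k] with [t j = false]
   and [M] large, and this position is divisible by [n] as soon as
   [j = k * (n - 1) %[mod n]].  Such a [j] exists in every residue class, because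
   some multiple of [n] has an odd number of binary digits 1, namely
   [1 + 2 ^ L + ... + 2 ^ (L * (n - 1))], and can be added in high position. *)
Require Import Defs.
From mathcomp Require Import all_boot.
From mathcomp Require Import boolp cyclic.

Lemma thue_morse_half (i : nat) : thue_morse i = odd i (+) thue_morse i./2.
Proof.
rewrite -{1}[i]odd_double_half -mul2n addnC; case: (odd i).
  by rewrite thue_morse_odd.
by rewrite addn0 thue_morse_even.
Qed.

(** [thue_morse] is the parity of the binary digit sum, and here the digits of [j] and [i] do not
    overlap. *)
Lemma thue_morse_cat (m j i : nat) :
  i < 2 ^ m -> thue_morse (2 ^ m * j + i) = thue_morse j (+) thue_morse i.
Proof.
elim: m i => [|m IHm] i lt_i.
  by move: lt_i; rewrite expn0 ltnS leqn0 mul1n => /eqP->; rewrite addn0 addbF.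
rewrite thue_morse_half [thue_morse i]thue_morse_half expnS -mulnA mul2n.
rewrite oddD odd_double /= halfD odd_double doubleK /= add0n IHm.
  by rewrite addbCA.
by rewrite ltn_half_double -mul2n -expnS.
Qed.

Lemma odd_multiple_thue_morse (n : nat) :
  odd n -> exists2 q, n %| q & thue_morse q.
Proof.
move=> odd_n; set L := totient n.
have L_gt0 : 0 < L by rewrite totient_gt0 odd_gt0.
have two_L : 2 ^ L = 1 %[mod n] by apply: Euler_exp_totient; rewrite coprime2n.
have [q q_mod tq] : exists2 q, q = n %[mod n] & thue_morse q = odd n.
  (* The modulus stays [n]; the residue and the parity become [c]. Passing to [2 ^ L * q + 1] adds 1
     to both. *)
  elim: {2 4}n => [|c [q q_mod tq]]; first by exists 0.
  exists (2 ^ L * q + 1).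
    by rewrite -modnDml -modnMml two_L modnMml mul1n q_mod modnDml addn1.
  by rewrite thue_morse_cat ?tq ?addbT // -{1}(expn0 2) ltn_exp2l.
by exists q; [rewrite /dvdn q_mod modnn | rewrite tq].
Qed.

Lemma thue_morse_residue (n r : nat) :
  odd n -> exists2 j, j = r %[mod n] & thue_morse j = false.
Proof.
move=> odd_n.
have [q n_q tq] : exists2 q, n %| q & thue_morse q = thue_morse r.
  case: (thue_morse r); last by exists 0; rewrite ?dvdn0.
  exact: odd_multiple_thue_morse.
exists (2 ^ r * q + r); last first.
  by rewrite (thue_morse_cat r q r (ltn_expl r (ltnSn 1))) tq addbb.
by rewrite -modnDml (eqP (dvdn_mull (2 ^ r) n_q)).
Qed.

Lemma thue_morse_factor_window (n k : nat) :
  odd n -> exists l, factor thue_morse n k = factor thue_morse n (l * n).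
Proof.
move=> odd_n; have n_gt0 := odd_gt0 odd_n.
have [j j_mod tj] := @thue_morse_residue n (k * n.-1) odd_n.
(* The factor [k + n] makes [2 ^ m] exceed every [k + i] with [i < n]. *)
set m := totient n * (k + n).
have two_m : 2 ^ m = 1 %[mod n].
  rewrite expnM -modnXm Euler_exp_totient ?coprime2n //.
  by rewrite modnXm exp1n.
have lt_m : k + n < 2 ^ m.
  apply: leq_trans (ltn_expl (k + n) (ltnSn 1)) _.
  by rewrite leq_exp2l // leq_pmull // totient_gt0.
have /dvdnP[l def_l] : n %| 2 ^ m * j + k.
  rewrite /dvdn -modnDml -modnMml two_m modnMml mul1n j_mod modnDml.
  by rewrite -{2}[k]muln1 -mulnDr addn1 prednK // modnMl.
exists l; rewrite -def_l; apply: eq_from_tnth => i; rewrite !tnth_mktuple.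
rewrite -addnA thue_morse_cat ?tj //.
by apply: leq_trans lt_m; rewrite ltnS leq_add2l ltnW.
Qed.

Lemma window_complexity_odd (n : nat) :
  odd n -> window_complexity thue_morse n = complexity thue_morse n.
Proof.
move=> odd_n; apply: eq_card => w; rewrite !inE.
apply/asboolP/asboolP => [[k ->]|[k ->]]; first by exists (k * n).
exact: thue_morse_factor_window.
Qed.

Definition thue_morse_morphism (n : nat) (w : n.-tuple bool) :
    (2 * n).-tuple bool :=
  [tuple odd i (+) nth false w i./2 | i < 2 * n].

(** The letters of even index in the image spell the original word. *)
Lemma thue_morse_morphism_inj (n : nat) : injective (@thue_morse_morphism n).
Proof.
move=> v w eq_vw; apply: eq_from_tnth => i.
have lt_i : 2 * i < 2 * n by rewrite ltn_pmul2l.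
move/(congr1 (fun u => tnth u (Ordinal lt_i))): eq_vw.
by rewrite !tnth_mktuple /= mul2n odd_double doubleK /= -!tnth_nth.
Qed.

Lemma thue_morse_morphism_factor (n k : nat) :
  thue_morse_morphism n (factor thue_morse n k) =
  factor thue_morse (2 * n) (2 * k).
Proof.
apply: eq_from_tnth => i; rewrite !tnth_mktuple.
have lt_i : i./2 < n by rewrite ltn_half_double -mul2n.
rewrite -[i./2]/(nat_of_ord (Ordinal lt_i)) -tnth_nth tnth_mktuple /=.
by rewrite [RHS]thue_morse_half [2 * k]mul2n oddD halfD odd_double doubleK add0n.
Qed.

Lemma window_complexity_double (n : nat) :
  window_complexity thue_morse (2 * n) = window_complexity thue_morse n.
Proof.
rewrite /window_complexity -[RHS](card_imset _ (@thue_morse_morphism_inj n)).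
apply: eq_card => w; rewrite inE; apply/asboolP/imsetP => [[k ->]|[v]].
  exists (factor thue_morse n (k * n)).
    by rewrite inE; apply/asboolP; exists k.
  by rewrite thue_morse_morphism_factor mulnCA.
rewrite inE => /asboolP[k ->] ->; exists k.
by rewrite thue_morse_morphism_factor mulnCA.
Qed.

Theorem theorem6p1 (n : nat) (hn : 1 <= n) :
  window_complexity thue_morse n = complexity thue_morse (n %/ 2 ^ logn 2 n) /\
  (odd n -> window_complexity thue_morse n = complexity thue_morse n).
Proof.
split; last exact: window_complexity_odd.
have [q q_odd def_n] := pfactor_coprime (isT : prime 2) hn.
rewrite {2}def_n mulnK ?expn_gt0 // {1}def_n.
(* With window complexities on both sides, only doublings of [q] remain. *)
rewrite coprime2n in q_odd; rewrite -window_complexity_odd //.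
elim: (logn 2 n) => [|v IHv]; first by rewrite muln1.
by rewrite expnS mulnCA window_complexity_double.
Qed.
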